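(* Let $n\ge2$ and let $\mu(dx)=\mu_r(d\rho)\,\mu_a(d\theta)$ be a nearly radial probability measure on $\mathbb R^n$. Then, for $t>0$, $$\beta^{SP}_\mu(t)\ \le\ \beta^{SP}_{\mu_r}(t/2)\ \beta^{SP}_{\mu_a}\!\left(\frac{t}{2\,\mu(\rho^2)\,\beta^{SP}_{\mu_r}(t/2)}\right).$$
   Context: Write $x=\rho\theta$ with $\rho=|x|\ge0$, $\theta\in\mathbb S^{n-1}$. $\mu$ is nearly radial if $\mu(dx)=\mu_r(d\rho)\,\mu_a(d\theta)$, i.e. $\mu$ is the image under $(\rho,\theta)\mapsto\rho\theta$ of $\mu_r\otimes\mu_a$, where $\mu_r$ is a probability measure on $\mathbb R^+$ with density proportional to $\rho^{n-1}e^{-V_r(\rho)}$ and $\mu_a$ is a probability measure on $\mathbb S^{n-1}$ with density proportional to $e^{-V_a(\theta)}$ with respect to the uniform measure. $\mu(\rho^2)=\int|x|^2d\mu=\int\rho^2\,\mu_r(d\rho)$. For a probability measure $\nu$, $\beta^{SP}_\nu$ denotes the (smallest) non-increasing function with values in $[1,+\infty]$ such that the super Poincaré inequality $$\nu(f^2)\le t\,\nu(|\nabla f|^2)+\beta^{SP}_\nu(t)\,\nu(|f|)^2$$ holds for all $t>0$ and all smooth $f$, where $\nu(f)=\int f\,d\nu$. For $\mu_r$, $|\nabla f|=|f'|$; for $\mu_a$, $\nabla$ is the Riemannian (tangential) gradient on $\mathbb S^{n-1}$. *)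

(* Defs.v *)
From HB Require Import structures.
From mathcomp Require Import all_boot all_order all_algebra.
From mathcomp Require Import all_classical all_reals all_analysis.

Set Implicit Arguments.
Unset Strict Implicit.
Unset Printing Implicit Defensive.

Import Order.TTheory GRing.Theory Num.Theory.
Import numFieldNormedType.Exports.

Local Open Scope classical_set_scope.
Local Open Scope ring_scope.

(* R^n with its Borel sigma-algebra.  The carrier is 'rV[R]_n, whose library
   norm is the sup norm: it is used for the topology and for derivatives only,
   the Euclidean norm is [enorm] below. *)
Notation Rn R n := (g_sigma_algebraType (@open 'rV[R]_n)).

Definition dot (R : realType) (n : nat) (u v : 'rV[R]_n) : R :=
  \sum_(i < n) u 0 i * v 0 i.

Definition enorm (R : realType) (n : nat) (u : 'rV[R]_n) : R :=
  Num.sqrt (dot u u).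

Definition sphere (R : realType) (n : nat) : set 'rV[R]_n :=
  [set x | enorm x = 1].

Fixpoint Ck_on (R : realType) (V : normedModType R) (k : nat) (U : set V)
    (f : V -> R) : Prop :=
  if k is k'.+1 then
    (forall x, U x -> differentiable f x) /\
    (forall v, Ck_on k' U (fun x => 'D_v f x))
  else forall x, U x -> {for x, continuous f}.

(* C^infty functions on U, meant for U open *)
Definition smooth_on (R : realType) (V : normedModType R) (U : set V)
    (f : V -> R) : Prop :=
  forall k, Ck_on k U f.

(* C^infty functions on a subset S of V which need not be open (here the closed
   half-line and the sphere): f is smooth on some open neighbourhood of S *)
Definition smooth_near (R : realType) (V : normedModType R) (S : set V)
    (f : V -> R) : Prop :=
  exists U : set V, [/\ open U, S `<=` U & smooth_on U f].

Definition grad (R : realType) (n : nat) (f : 'rV[R]_n -> R) (x : 'rV[R]_n)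
    : 'rV[R]_n :=
  \row_(i < n) 'D_(delta_mx 0 i) f x.

(* For x on the unit sphere, the orthogonal projection of grad f x on the
   tangent space at x: the Riemannian gradient at x of the restriction of f to
   the sphere, which does not depend on the values of f off the sphere *)
Definition tgrad (R : realType) (n : nat) (f : 'rV[R]_n -> R) (x : 'rV[R]_n)
    : 'rV[R]_n :=
  grad f x - dot (grad f x) x *: x.

Section super_poincare.
Context {d : measure_display} {T : measurableType d} {R : realType}.
(* nu is carried by D, C is the class of test functions (only their values
   around D matter) and G f x stands for |nabla f| (x) *)
Variables (nu : probability T R) (D : set T) (C : set (T -> R)).
Variable G : (T -> R) -> T -> R.
Local Open Scope ereal_scope.

(* Integrals are taken in [0, +oo], so that no integrability is required of the
   test functions *)
Definition super_poincare (t : R) (b : \bar R) : Prop :=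
  forall f, C f ->
    \int[nu]_(x in D) ((f x) ^+ 2)%:E <=
      t%:E * \int[nu]_(x in D) ((G f x) ^+ 2)%:E
      + b * (\int[nu]_(x in D) (`|f x|%R)%:E) ^+ 2.

Definition SP_function (beta : R -> \bar R) : Prop :=
  [/\ forall s t, (0 < s)%R -> (s <= t)%R -> beta t <= beta s,
      forall t, (0 < t)%R -> 1 <= beta t
    & forall t, (0 < t)%R -> super_poincare t (beta t)].

(* The smallest non-increasing function ]0, +oo[ -> [1, +oo] for which the
   super Poincare inequality holds.  Outside of ]0, +oo[ it is set to +oo: an
   argument t / (2 * m * b) with m * b = +oo is equal to 0, and must be given
   the value beta(0) = +oo. *)
Definition betaSP (t : R) : \bar R :=
  if (0 < t)%R then ereal_inf [set beta t | beta in SP_function] else +oo.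

End super_poincare.

Definition halfline (R : realType) : set R := `[0, +oo[.

Definition betaSP_Rn (R : realType) (n : nat) (mu : probability (Rn R n) R)
    : R -> \bar R :=
  betaSP mu setT (@smooth_on R 'rV[R]_n setT) (fun f x => enorm (grad f x)).

Definition betaSP_halfline (R : realType)
    (mu : probability (measurableTypeR R) R) : R -> \bar R :=
  betaSP mu (@halfline R) (@smooth_near R R^o (@halfline R))
    (fun f x => `|derive1 (f : R -> R) x|).

Definition betaSP_sphere (R : realType) (n : nat)
    (mu : probability (Rn R n) R) : R -> \bar R :=
  betaSP mu (@sphere R n) (@smooth_near R 'rV[R]_n (@sphere R n))
    (fun f x => enorm (tgrad f x)).

(* nu is carried by D, with density proportional to g with respect to lambda *)
Definition density_proportional (d : measure_display) (T : measurableType d)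
    (R : realType) (nu : probability T R) (lambda : {measure set T -> \bar R})
    (D : set T) (g : T -> R) : Prop :=
  measurable_fun D g /\
  exists2 c : R, 0 < c & forall A : set T, measurable A ->
    (nu A = c%:E * \int[lambda]_(x in A `&` D) (g x)%:E)%E.

(* the uniform measure on the sphere, i.e. the rotation-invariant probability
   measure carried by it *)
Definition uniform_sphere (R : realType) (n : nat)
    (sigma : probability (Rn R n) R) : Prop :=
  sigma (@sphere R n) = 1%E /\
  forall Q : 'M[R]_n, Q *m Q^T = 1%:M ->
  forall A : set (Rn R n), measurable A ->
    sigma ((fun x : 'rV[R]_n => x *m Q) @^-1` A) = sigma A.

Definition nearly_radial (R : realType) (n : nat)
    (Vr : R -> R) (Va : 'rV[R]_n -> R) (sigma : probability (Rn R n) R)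
    (mur : probability (measurableTypeR R) R) (mua mu : probability (Rn R n) R)
    : Prop :=
  [/\ density_proportional mur (@lebesgue_measure R) (@halfline R)
        (fun rho => rho ^+ n.-1 * expR (- Vr rho)),
      density_proportional mua sigma (@sphere R n)
        (fun theta => expR (- Va theta))
    & forall A : set (Rn R n), measurable A ->
        mu A = (mur \x mua)%E
          ((fun p : R * 'rV[R]_n => p.1 *: p.2) @^-1` A)].

(* Main.v *)
Require Import Defs.
From HB Require Import structures.
From mathcomp Require Import all_boot all_order all_algebra.
From mathcomp Require Import all_classical all_reals all_analysis.
From mathcomp Require Import measurable_realfun ring lra.

Set Implicit Arguments.
Unset Strict Implicit.
Unset Printing Implicit Defensive.

Import Order.TTheory GRing.Theory Num.Theory.
Import numFieldNormedType.Exports.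

Local Open Scope classical_set_scope.
Local Open Scope ring_scope.

(** In polar coordinates x = rho theta the squared gradient of f splits into a
    radial part and a part tangent to the sphere of radius rho.

    For fixed theta the radial super Poincare inequality, applied to the function
    rho |-> f (rho theta), gives
      int f(rho theta)^2 dmur <= t/2 int (radial part)^2 dmur + br g(theta)^2,
    where g(theta) = int |f (rho theta)| dmur.  It remains to integrate over theta,
    and to bound int g^2 dmua by the spherical super Poincare inequality for g with
    time s = t / (2 m2 br).  Since theta |-> f (rho theta) has spherical gradient
    rho times the tangential part of the gradient of f, Cauchy-Schwarz gives
      |grad g|^2 <= m2 int (tangential part)^2 dmur,
    so that the tangential energy enters with coefficient br s m2 = t/2, and
    int g dmua = int |f| dmu is the required L^1 norm.

    The difficulty is that g is not smooth: f may vanish, the integral runs over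
    an unbounded half-line, and nothing bounds the derivatives of f at infinity.
    The spherical inequality is therefore applied to finite sums
      G(theta) = sum_i w_i sqrt (f (r_i theta)^2 + e^2) + e,
    where the r_i are the left ends of the cells of a fine mesh of [0, K[ and w_i is
    the mass of the i-th cell (ray_sum).  Such a G is smooth on the whole space; the
    gradient estimate above is a Cauchy-Schwarz inequality for finite sums
    (tgrad_ray_sum_le); and uniform continuity on [0, K] x sphere compares every sum
    with the corresponding integral up to e (unif_radial, riemann_le, riemann_ge).
    In particular G dominates the truncated g.  Then e tends to 0, and K to infinity
    by monotone convergence (tangential_super_poincare).

    All integrals take values in [0, +oo], which covers the functions f with
    infinite integrals.  The passage between betaSP and the inequalities themselves is given by
    betaSP_attained and betaSP_le.  If the argument of the second factor is 0, or if
    one of the factors is infinite, then the bound is +oo. *)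

(** * Smooth functions on normed spaces *)

Section smooth.
Context {R : realType} {V : normedModType R}.
Implicit Types f g : V -> R.

Lemma Ck_diff k f x : Ck_on k.+1 setT f -> differentiable f x.
Proof. by case=> + _; exact. Qed.

Lemma CkW k f : Ck_on k.+1 setT f -> Ck_on k setT f.
Proof.
elim: k f => [|k IH] f [df Df].
  by move=> x _; exact/differentiable_continuous/df.
by split=> // v; exact/IH/Df.
Qed.

Lemma Ck_cst k (c : R) : Ck_on k setT (fun _ : V => c).
Proof.
elim: k c => [|k IH] c /=; first by move=> x _; exact: cst_continuous.
split=> [x _|v]; first exact: differentiable_cst.
suff -> : (fun x : V => 'D_v (fun _ : V => c) x) = fun=> 0 by [].
by apply/funext => x; rewrite derive_cst.
Qed.

Lemma CkD k f g : Ck_on k setT f -> Ck_on k setT g ->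
  Ck_on k setT (fun x => f x + g x).
Proof.
elim: k f g => [|k IH] f g.
  by move=> cf cg x _; apply: continuousD; [exact: cf|exact: cg].
move=> Cf Cg; split=> [x _|v].
  by apply: differentiableD; [exact: (Ck_diff x Cf)|exact: (Ck_diff x Cg)].
suff -> : (fun x : V => 'D_v (fun x => f x + g x) x) =
    fun x => 'D_v f x + 'D_v g x.
  by apply: IH; [exact: Cf.2|exact: Cg.2].
apply/funext => x; rewrite deriveD//; apply: diff_derivable;
  [exact: (Ck_diff x Cf)|exact: (Ck_diff x Cg)].
Qed.

Lemma CkM k f g : Ck_on k setT f -> Ck_on k setT g ->
  Ck_on k setT (fun x => f x * g x).
Proof.
elim: k f g => [|k IH] f g.
  by move=> cf cg x _; apply: continuousM; [exact: cf|exact: cg].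
move=> Cf Cg; split=> [x _|v].
  by apply: differentiableM; [exact: (Ck_diff x Cf)|exact: (Ck_diff x Cg)].
suff -> : (fun x : V => 'D_v (fun x => f x * g x) x) =
    fun x => f x * 'D_v g x + g x * 'D_v f x.
  by apply: CkD; apply: IH; [exact: CkW|exact: Cg.2|exact: CkW|exact: Cf.2].
apply/funext => x; rewrite deriveM//; apply: diff_derivable;
  [exact: (Ck_diff x Cf)|exact: (Ck_diff x Cg)].
Qed.

Lemma Ck_sum k (m : nat) (F : 'I_m -> V -> R) :
  (forall i, Ck_on k setT (F i)) -> Ck_on k setT (fun x => \sum_(i < m) F i x).
Proof.
move=> CF; elim: m F CF => [|m IH] F CF.
  under eq_fun do rewrite big_ord0.
  exact: Ck_cst.
under eq_fun do rewrite big_ord_recl.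
by apply: CkD => //; exact: IH.
Qed.

End smooth.

Section smooth_linear.
Context {R : realType} {V W : normedModType R}.
Variable L : V -> W.
Hypotheses (linL : linear L) (dL : forall x, differentiable L x).

Lemma derive_comp_linear (f : W -> R) (v x : V) :
  'D_v (fun y => f (L y)) x = 'D_(L v) f (L x).
Proof.
rewrite /derive.
have -> // : (fun h : R => h^-1 *: (((fun y => f (L y)) \o shift x) (h *: v)
      - f (L x))) =
    (fun h : R => h^-1 *: ((f \o shift (L x)) (h *: L v) - f (L x))).
by apply/funext => h /=; rewrite linL.
Qed.

Lemma Ck_comp_linear k (f : W -> R) :
  Ck_on k setT f -> Ck_on k setT (fun x => f (L x)).
Proof.
elim: k f => [|k IH] f.
  move=> cf x _; apply: (@continuous_comp _ _ _ L f); first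
    exact: differentiable_continuous.
  exact: cf.
move=> Cf; split=> [x _|v].
  by apply: (@differentiable_comp _ _ _ _ L f) => //; exact: (Ck_diff _ Cf).
under eq_fun do rewrite derive_comp_linear.
exact: IH (Cf.2 _).
Qed.

End smooth_linear.

Section smooth_abs.
Context {R : realType} (e : R).
Hypothesis e0 : 0 < e.

(** A smooth substitute for the absolute value: super Poincare inequalities are
    available for smooth functions only, and |f| is not one of them. *)
Definition smooth_abs (u : R) : R := Num.sqrt (u ^+ 2 + e ^+ 2).

Lemma smooth_abs_gt0 u : 0 < smooth_abs u.
Proof. by rewrite sqrtr_gt0 ltr_wpDl ?sqr_ge0// exprn_gt0. Qed.

Lemma smooth_abs_sq u : smooth_abs u ^+ 2 = u ^+ 2 + e ^+ 2.
Proof. by rewrite sqr_sqrtr// addr_ge0// sqr_ge0. Qed.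

Lemma le_abs_smooth_abs u : `|u| <= smooth_abs u.
Proof.
rewrite -(@ler_pXn2r _ 2) ?nnegrE// ?(ltW (smooth_abs_gt0 _))//.
by rewrite smooth_abs_sq real_normK ?num_real// lerDl sqr_ge0.
Qed.

Lemma smooth_abs_le u : smooth_abs u <= `|u| + e.
Proof.
rewrite -(@ler_pXn2r _ 2) ?nnegrE// ?(ltW (smooth_abs_gt0 _))//; last first.
  by rewrite addr_ge0// ltW.
rewrite smooth_abs_sq sqrrD real_normK ?num_real//.
by rewrite lerD2r lerDl mulrn_wge0// mulr_ge0// ltW.
Qed.

Lemma is_derive_smooth_abs (u : R) : is_derive u 1 smooth_abs (u / smooth_abs u).
Proof.
have h : is_derive u (1 : R) (fun u : R => u ^+ 2 + e ^+ 2) (2 * u).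
  apply: is_derive_eq. rewrite /GRing.scale /=; ring.
have p : 0 < u ^+ 2 + e ^+ 2 by rewrite ltr_wpDl ?sqr_ge0// exprn_gt0.
have := @is_derive1_comp _ Num.sqrt (fun u => u ^+ 2 + e ^+ 2) _ _ _
  (is_derive1_sqrt p) h.
move=> /is_derive_eq; apply.
by rewrite invfM -/(smooth_abs u); field; rewrite gt_eqF ?smooth_abs_gt0.
Qed.

Context {V : normedModType R}.
Implicit Types f : V -> R.

Lemma differentiable_smooth_abs f x : differentiable f x ->
  differentiable (fun y => smooth_abs (f y)) x.
Proof.
move=> df; apply: (@differentiable_comp _ _ _ _ f smooth_abs) => //.
by have [dphi _] := is_derive_smooth_abs (f x); exact/derivable1_diffP.
Qed.

Lemma derive_smooth_abs f x v : differentiable f x ->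
  'D_v (fun y => smooth_abs (f y)) x = f x / smooth_abs (f x) * 'D_v f x.
Proof.
move=> df; have [dphi phia] := is_derive_smooth_abs (f x).
have dp : differentiable smooth_abs (f x) by exact/derivable1_diffP.
rewrite deriveE; last exact: differentiable_smooth_abs.
rewrite (@diff_comp _ _ _ _ f smooth_abs)//= (diff1E dp)/= -deriveE//.
by rewrite derive1E phia /GRing.scale/= mulrC.
Qed.

(** The reciprocal comes first because its derivative - u / smooth_abs(u)^3 is a
    polynomial in u and 1 / smooth_abs(u), which makes the induction on k close
    on itself; smooth_abs is then (u^2 + e^2) / smooth_abs(u). *)
Lemma Ck_smooth_absV k f : Ck_on k setT f ->
  Ck_on k setT (fun x => (smooth_abs (f x))^-1).
Proof.
have n0 u : smooth_abs u != 0 by rewrite gt_eqF ?smooth_abs_gt0.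
elim: k f => [|k IH] f.
  move=> cf x _; apply: continuousV; first exact: n0.
  apply: (@continuous_comp _ _ _ f smooth_abs); first exact: cf.
  apply/differentiable_continuous/derivable1_diffP.
  by case: (is_derive_smooth_abs (f x)).
move=> Cf; split=> [x _|v].
  by apply: differentiableV => //; exact/differentiable_smooth_abs/(Ck_diff x Cf).
pose w x := (smooth_abs (f x))^-1.
have -> : (fun x : V => 'D_v (fun x => (smooth_abs (f x))^-1) x) =
    fun x => -1 * (f x * (w x * (w x * w x)) * 'D_v f x).
  apply/funext => x; have df := Ck_diff x Cf.
  rewrite deriveV//; last exact/diff_derivable/differentiable_smooth_abs.
  rewrite derive_smooth_abs// /w /GRing.scale/=; field; exact: n0.
have Cw : Ck_on k setT w by exact/IH/CkW.
apply: CkM; first exact: Ck_cst.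
apply: CkM; last exact: Cf.2.
by apply: CkM; [exact: CkW|do 2 apply: CkM => //].
Qed.

Lemma Ck_smooth_abs k f : Ck_on k setT f ->
  Ck_on k setT (fun x => smooth_abs (f x)).
Proof.
move=> Cf.
have -> : (fun x => smooth_abs (f x)) =
    fun x => (f x * f x + e ^+ 2) * (smooth_abs (f x))^-1.
  apply/funext => x; rewrite -expr2 -smooth_abs_sq expr2 mulfK//.
  by rewrite gt_eqF ?smooth_abs_gt0.
apply: CkM; last exact: Ck_smooth_absV.
by apply: CkD; [exact: CkM|exact: Ck_cst].
Qed.

End smooth_abs.

(** * Euclidean geometry and sums along rays *)

Section euclidean.
Context {R : realType} {n : nat}.
Implicit Types (u v x theta : 'rV[R]_n) (f : 'rV[R]_n -> R).

Lemma dot_ge0 u : 0 <= dot u u.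
Proof. by apply: sumr_ge0 => i _; rewrite -expr2 sqr_ge0. Qed.

Lemma enorm_sq u : enorm u ^+ 2 = dot u u.
Proof. by rewrite /enorm sqr_sqrtr// dot_ge0. Qed.

Lemma sphere_dot theta : @sphere R n theta -> dot theta theta = 1.
Proof. by rewrite /sphere/= -enorm_sq => ->; rewrite expr1n. Qed.

Lemma dotZl a u v : dot (a *: u) v = a * dot u v.
Proof. by rewrite /dot mulr_sumr; apply: eq_bigr => i _; rewrite mxE mulrA. Qed.

Lemma dotC u v : dot u v = dot v u.
Proof. by apply: eq_bigr => i _; rewrite mulrC. Qed.

Lemma dotDl u1 u2 v : dot (u1 + u2) v = dot u1 v + dot u2 v.
Proof. by rewrite /dot -big_split; apply: eq_bigr => i _; rewrite mxE mulrDl. Qed.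

Lemma dot_suml m (F : 'I_m -> 'rV[R]_n) v :
  dot (\sum_(i < m) F i) v = \sum_(i < m) dot (F i) v.
Proof.
rewrite /dot exchange_big; apply: eq_bigr => i _.
by rewrite summxE mulr_suml.
Qed.

(** Orthogonal projection on the hyperplane normal to theta, when theta is a unit
    vector: tgrad f x is tproj (grad f x) x. *)
Definition tproj u theta : 'rV[R]_n := u - dot u theta *: theta.

Lemma pythagoras u theta : dot theta theta = 1 ->
  enorm u ^+ 2 = dot u theta ^+ 2 + enorm (tproj u theta) ^+ 2.
Proof.
move=> t1; rewrite !enorm_sq /tproj -scaleNr.
rewrite dotDl [dot u (_ + _)]dotC dotDl dotZl [dot (_ *: _) (_ + _)]dotZl.
rewrite [dot theta (_ + _)]dotC dotDl dotZl t1 [dot theta u]dotC.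
by ring.
Qed.

(** For all x and y the sum of the w_i (x a_i - y b_i)^2 is nonnegative; x = S
    and y = A, with S the cross sum and A the sum of the w_i a_i^2, give the
    inequality when A > 0, and every w_i a_i vanishes when A = 0. *)
Lemma weighted_cauchy_schwarz m (w a b : 'I_m -> R) :
  (forall i, 0 <= w i) ->
  (\sum_i w i * a i * b i) ^+ 2 <=
  (\sum_i w i * a i ^+ 2) * (\sum_i w i * b i ^+ 2).
Proof.
move=> w0; set A := \sum_i w i * a i ^+ 2; set B := \sum_i w i * b i ^+ 2.
set S := \sum_i _.
have A0 : 0 <= A by apply: sumr_ge0 => i _; rewrite mulr_ge0 ?sqr_ge0.
have key (x y : R) : 0 <= x ^+ 2 * A + y ^+ 2 * B - 2 * x * y * S.
  have -> : x ^+ 2 * A + y ^+ 2 * B - 2 * x * y * S =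
      \sum_i w i * (x * a i - y * b i) ^+ 2.
    rewrite /A /B /S !mulr_sumr -!(big_split,sumrB)/=.
    by apply: eq_bigr => i _; ring.
  by apply: sumr_ge0 => i _; rewrite mulr_ge0 ?sqr_ge0.
have [A00|An0] := eqVneq A 0.
  have aw i : w i * a i = 0.
    have /eqP := A00; rewrite psumr_eq0; last first.
      by move=> j _; rewrite mulr_ge0 ?sqr_ge0.
    move=> /allP/(_ i); rewrite mem_index_enum => /(_ isT)/=.
    by rewrite expr2 mulrA mulf_eq0 => /orP[/eqP//|/eqP ->]; rewrite mulr0.
  rewrite A00 mul0r /S big1 ?expr0n//= => i _.
  by rewrite aw mul0r.
have Ap : 0 < A by rewrite lt_def An0.
have := key S A.
have -> : S ^+ 2 * A + A ^+ 2 * B - 2 * S * A * S = A * (A * B - S ^+ 2) by ring.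
by rewrite pmulr_rge0// subr_ge0.
Qed.

Lemma derive_dot f x v : differentiable f x -> 'D_v f x = dot (grad f x) v.
Proof.
move=> df; rewrite deriveE// [in LHS](row_sum_delta v) linear_sum /dot.
apply: eq_bigr => i _; rewrite linearZ/= mxE deriveE//.
by rewrite /GRing.scale/= mulrC.
Qed.

Lemma smooth_grad_continuous f i : smooth_on setT f ->
  continuous (fun x => grad f x 0 i).
Proof.
move=> /(_ 2%N) Cf x; have [_ /(_ (delta_mx 0 i)) [d _]] := Cf.
have -> : (fun x => grad f x 0 i) = (fun x => 'D_(delta_mx 0 i) f x).
  by apply/funext => y; rewrite mxE.
exact/differentiable_continuous/d.
Qed.

Lemma smooth_diff f x : smooth_on setT f -> differentiable f x.
Proof. by move=> /(_ 1%N)/Ck_diff; exact. Qed.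

Lemma smooth_continuous f : smooth_on setT f -> continuous f.
Proof. by move=> sf x; exact/differentiable_continuous/smooth_diff. Qed.

End euclidean.

Section radial.
Context {R : realType} {n : nat}.
Variable f : 'rV[R]_n -> R.
Hypothesis sf : smooth_on setT f.

Let ray_linear (theta : 'rV[R]_n) : linear (fun r : R^o => r *: theta).
Proof. by move=> a x y; rewrite scalerDl scalerA. Qed.

Lemma smooth_ray (theta : 'rV[R]_n) :
  smooth_on (setT : set R^o) (fun r => f (r *: theta)).
Proof. move=> k; apply: Ck_comp_linear => //; exact: ray_linear. Qed.

Lemma derive1_ray (theta : 'rV[R]_n) (r : R) :
  derive1 (fun r : R => f (r *: theta)) r = dot (grad f (r *: theta)) theta.
Proof.
rewrite derive1E (@derive_comp_linear _ R^o _ _ (ray_linear theta)) scale1r.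
by rewrite derive_dot//; exact: smooth_diff.
Qed.

Variables (m : nat) (w r : 'I_m -> R) (e : R).
Hypotheses (w0 : forall i, 0 <= w i) (e0 : 0 < e).

(** With nodes r_i and weights w_i this is a Riemann sum of the integral of
    |f (rho x)| over rho, with the absolute value smoothed.  It is smooth in x on
    all of R^n because the sum is finite, and the final e leaves room for the sum
    to dominate the integral. *)
Definition ray_sum (x : 'rV[R]_n) : R :=
  \sum_(i < m) w i * smooth_abs e (f (r i *: x)) + e.

Let scale_linear (c : R) : linear (fun x : 'rV[R]_n => c *: x).
Proof. by move=> a x y; rewrite scalerDr !scalerA mulrC. Qed.

Lemma smooth_ray_sum : smooth_on setT ray_sum.
Proof.
move=> k; apply: CkD; last exact: Ck_cst.
apply: Ck_sum => i; apply: CkM; first exact: Ck_cst.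
by apply: Ck_smooth_abs => //; apply: Ck_comp_linear => //; exact: scale_linear.
Qed.

Let c i x : R := f (r i *: x) / smooth_abs e (f (r i *: x)).

Lemma grad_ray_sum x : grad ray_sum x =
  \sum_(i < m) (w i * r i * c i x) *: grad f (r i *: x).
Proof.
have ds i : differentiable (fun y => f (r i *: y)) x.
  by apply: (@Ck_diff _ _ 0); apply: Ck_comp_linear => //; exact: scale_linear.
have dss i : differentiable (fun y => smooth_abs e (f (r i *: y))) x.
  exact: differentiable_smooth_abs.
apply/rowP => j; rewrite mxE summxE.
have -> : ray_sum =
    \sum_(i < m) (cst (w i) * (fun y => smooth_abs e (f (r i *: y)))) + cst e.
  by apply/funext => y; rewrite /= fctE fct_sumE.
have d1 i : derivable (cst (w i) * (fun y => smooth_abs e (f (r i *: y)))) x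
    (delta_mx 0 j).
  by apply: derivableM => //; exact: diff_derivable.
rewrite deriveD//; last exact: derivable_sum.
rewrite derive_cst addr0 derive_sum//.
apply: eq_bigr => i _; rewrite deriveM//; last exact: diff_derivable.
rewrite derive_cst scaler0 addr0 derive_smooth_abs//.
rewrite (derive_comp_linear (@scale_linear _)) derive_dot; last exact: smooth_diff.
rewrite dotC dotZl dotC -derive_dot; last exact: smooth_diff.
rewrite !mxE /GRing.scale/= /c; ring.
Qed.

(** Moving theta along the sphere moves the point r_i theta r_i times as fast,
    hence the factor r_i in the gradient; the derivative of smooth_abs is bounded
    by 1, and Cauchy-Schwarz separates the r_i from the gradients of f. *)
Lemma tgrad_ray_sum_le theta : enorm (tgrad ray_sum theta) ^+ 2 <=
  (\sum_(i < m) w i * r i ^+ 2) *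
  (\sum_(i < m) w i * enorm (tproj (grad f (r i *: theta)) theta) ^+ 2).
Proof.
pose u i := tproj (grad f (r i *: theta)) theta.
have tE : tgrad ray_sum theta = \sum_(i < m) (w i * r i * c i theta) *: u i.
  rewrite /tgrad grad_ray_sum dot_suml scaler_suml -sumrB.
  by apply: eq_bigr => i _; rewrite dotZl scalerBr scalerA.
have c1 i : c i theta ^+ 2 <= 1.
  rewrite /c expr_div_n ler_pdivrMr ?exprn_gt0 ?smooth_abs_gt0//.
  rewrite mul1r smooth_abs_sq.
  by rewrite lerDl sqr_ge0.
rewrite tE enorm_sq /dot.
under eq_bigr do rewrite -expr2 summxE.
under [X in _ <= _ * X]eq_bigr do rewrite enorm_sq /dot mulr_sumr.
rewrite exchange_big/= mulr_sumr; apply: ler_sum => j _.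
under eq_bigr do rewrite mxE.
have -> : \sum_(i < m) (w i * r i * c i theta) * u i 0 j =
    \sum_(i < m) w i * (r i * c i theta) * u i 0 j.
  by apply: eq_bigr => i _; rewrite mulrA.
apply: (le_trans (weighted_cauchy_schwarz _ _ w0)).
under [X in _ <= _ * X]eq_bigr do rewrite -expr2.
apply: ler_wpM2r; first by apply: sumr_ge0 => i _; rewrite mulr_ge0 ?sqr_ge0.
apply: ler_sum => i _; rewrite ler_wpM2l// exprMn ler_piMr ?sqr_ge0//.
Qed.

End radial.

(** * Borel sets of R^n and polar coordinates *)

Section borel.
Context {R : realType} {n : nat}.

Lemma measurable_Rn_continuous (f : 'rV[R]_n -> R) : continuous f ->
  measurable_fun setT (f : Rn R n -> R).
Proof.
move=> /continuousP cf.
apply: (measurability _ (RGenOpens.measurableE R)).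
move=> _ [_ [a [b ->] <-]]; rewrite setTI; apply: sub_sigma_algebra.
exact/cf/interval_open.
Qed.

(** The open boxes with rational corners form a countable base of R^n, and the
    preimage of a box is a finite intersection of coordinate conditions. *)
Lemma measurable_fun_coord d (T : measurableType d) (h : T -> Rn R n) :
  (forall i, measurable_fun setT (fun x => (h x : 'rV[R]_n) 0 i)) ->
  measurable_fun setT h.
Proof.
move=> mh; apply: (@measurability _ _ _ _ setT h (@open 'rV[R]_n) erefl).
move=> _ [U oU <-]; rewrite setTI.
pose box (q : {ffun 'I_n -> rat * rat}) : set 'rV[R]_n :=
  [set x | forall i, ratr (q i).1 < x 0 i < ratr (q i).2].
have -> : h @^-1` U = \bigcup_q
    (if `[< box q `<=` U >] then h @^-1` (box q) else set0).
  apply/seteqP; split=> [x /= Ux|x [q _]]; last first.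
    by case: ifPn => // /asboolP qU; exact: qU.
  have /nbhs_ballP[e /= e0 eU] := open_nbhs_nbhs (conj oU Ux).
  have pick i : exists q : rat * rat,
      ratr q.1 < (h x : 'rV[R]_n) 0 i < ratr q.2 /\
      (h x : 'rV[R]_n) 0 i - e < ratr q.1 /\
      ratr q.2 < (h x : 'rV[R]_n) 0 i + e.
    have [a] := @rat_in_itvoo R ((h x : 'rV[R]_n) 0 i - e)
      ((h x : 'rV[R]_n) 0 i) ltac:(by rewrite ltrBlDr ltrDl).
    have [b] := @rat_in_itvoo R ((h x : 'rV[R]_n) 0 i)
      ((h x : 'rV[R]_n) 0 i + e) ltac:(by rewrite ltrDl).
    rewrite !in_itv/= => /andP[b1 b2] /andP[a1 a2].
    by exists (a, b) => /=; rewrite a2 b1.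
  have [q qP] := choice pick.
  exists [ffun i => q i] => //.
  have bx : box [ffun i => q i] (h x) by move=> i; rewrite ffunE; have [] := qP i.
  case: ifPn => // /asboolP; apply => y yq; apply: eU.
  split=> // i j; rewrite ord1 /ball/= distrC.
  have := yq j; rewrite ffunE => /andP[y1 y2].
  have [_ [q1 q2]] := qP j.
  by rewrite ltr_distl; apply/andP; split; [exact: lt_trans y1|exact: lt_trans q2].
apply: countable_bigcupT_measurable => [|q]; first exact: countableP.
case: ifP => // _.
have -> : h @^-1` box q = \bigcap_(i in [set: 'I_n])
    (setT `&` ((fun x => (h x : 'rV[R]_n) 0 i) @^-1`
       `]ratr (q i).1, ratr (q i).2[%classic)).
  apply/seteqP; split=> [x /= xq i _|x /= xq i].
    by split=> //=; rewrite in_itv/= xq.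
  by have [_ /=] := xq i Logic.I; rewrite in_itv.
apply: fin_bigcap_measurable; first exact: finite_finset.
by move=> i _; apply: mh => //; exact: measurable_itv.
Qed.

Lemma measurable_coord (i : 'I_n) :
  measurable_fun setT (fun x : Rn R n => (x : 'rV[R]_n) 0 i).
Proof. by apply: measurable_Rn_continuous; exact: coord_continuous. Qed.

Definition polar (p : R * 'rV[R]_n) : 'rV[R]_n := p.1 *: p.2.

Lemma measurable_polar :
  measurable_fun setT (polar : measurableTypeR R * Rn R n -> Rn R n).
Proof.
apply: measurable_fun_coord => i; rewrite /polar.
have -> : (fun x : measurableTypeR R * Rn R n =>
    ((x.1 : R) *: (x.2 : 'rV[R]_n)) 0 i) =
    (fun x => (x.1 : R) * (x.2 : 'rV[R]_n) 0 i).
  by apply/funext => x; rewrite mxE.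
apply: measurable_funM; first exact: measurable_fst.
exact: measurableT_comp (measurable_coord i) measurable_snd.
Qed.

Lemma measurable_sphere : measurable (@sphere R n : set (Rn R n)).
Proof.
have -> : @sphere R n = setT `&` (fun x => dot x x) @^-1` [set 1].
  apply/seteqP; split=> [x /sphere_dot //|x [_ /= x1]].
  by rewrite /sphere/= /enorm x1 sqrtr1.
suff mf : measurable_fun setT
    ((fun x => dot x x) : Rn R n -> R) by exact: mf.
apply: measurable_sum => i; apply: measurable_funM; exact: measurable_coord.
Qed.

Lemma measurable_halfline : measurable (@halfline R : set (measurableTypeR R)).
Proof. exact: measurable_itv. Qed.

End borel.

Lemma density_carried d (T : measurableType d) (R : realType)
    (nu : probability T R) (lambda : {measure set T -> \bar R})
    (D : set T) (g : T -> R) : measurable D ->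
  density_proportional nu lambda D g -> nu (~` D) = 0%E.
Proof.
move=> mD [_ [c _ nuE]].
by rewrite nuE ?setICl ?integral_set0 ?mule0//; exact: measurableC.
Qed.

(** * The function betaSP *)

Section betaSP_facts.
Context {d : measure_display} {T : measurableType d} {R : realType}.
Variables (nu : probability T R) (D : set T) (C : set (T -> R)).
Variable G : (T -> R) -> T -> R.
Hypothesis mD : measurable D.
Local Open Scope ereal_scope.
Notation SP := (super_poincare nu D C G).
Notation beta := (betaSP nu D C G).

Lemma betaSP_ge1 t : 1 <= beta t.
Proof.
rewrite /betaSP; case: ifPn => [t0|_]; last exact: leey.
by apply: le_ereal_inf_tmp => _ [b [_ b1 _] <-]; exact: b1.
Qed.

(** The inequality is affine in its second coefficient, so it passes to the
    infimum which defines betaSP.  When the integral of |f| is infinite the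
    right-hand side is infinite, because betaSP is positive. *)
Lemma betaSP_attained t : (0 < t)%R -> beta t < +oo -> SP t (beta t).
Proof.
move=> t0 bfin f Cf.
have bnum : beta t \is a fin_num.
  by rewrite ge0_fin_numE// (le_trans _ (betaSP_ge1 t)).
set a := \int[nu]_(x in D) _; set E := \int[nu]_(x in D) _.
set M := \int[nu]_(x in D) _.
have E0 : 0 <= E by apply: integral_ge0 => x _; rewrite lee_fin sqr_ge0.
have M0 : 0 <= M by apply: integral_ge0 => x _; rewrite lee_fin.
have [Moo|Mfin] := eqVneq M +oo.
  rewrite Moo expe2 gt0_mulye//.
  rewrite gt0_muley ?(lt_le_trans _ (betaSP_ge1 t))// addey ?leey//.
  by rewrite gt_eqF// (lt_le_trans _ (mule_ge0 _ E0))// ?ltNy0// lee_fin ltW.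
have Mnum : M \is a fin_num by rewrite ge0_fin_numE// ltey.
apply/lee_addgt0Pr => e e0.
have e'0 : (0 < e / (fine M ^+ 2 + 1))%R.
  by rewrite divr_gt0// ltr_wpDl ?sqr_ge0.
have bE : beta t = ereal_inf [set b t | b in SP_function nu D C G].
  by rewrite /betaSP t0.
have [_ [b [_ _ bSP] <-]] := @lb_ereal_inf_adherent _ _ _ e'0
  (eq_ind _ (fun x => x \is a fin_num) bnum _ bE).
rewrite -bE => /ltW bt.
apply: (le_trans (bSP t t0 f Cf)); rewrite -addeA leeD2l//.
apply: (@le_trans _ _ ((beta t + (e / (fine M ^+ 2 + 1))%:E) * M ^+ 2)).
  by apply: lee_wpmul2r => //; exact: expe_ge0.
rewrite -(fineK bnum) -(fineK Mnum) -EFin_expe -EFinD -!EFinM lee_fin/=.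
rewrite mulrDl lerD2l ltW// mulrAC ltr_pdivrMr ?ltr_wpDl ?sqr_ge0//.
by rewrite ltr_pM2l// ltrDl.
Qed.

(** When the integral of |f| vanishes the product with +oo is 0, and the
    inequality holds because f is then 0 almost everywhere. *)
Lemma super_poincare_pinfty t : (0 < t)%R ->
  (forall f, C f -> measurable_fun D f) -> SP t +oo.
Proof.
move=> t0 mC f Cf; have mf := mC f Cf.
set E := \int[nu]_(x in D) ((G _ _) ^+ 2)%:E.
have E0 : 0 <= E by apply: integral_ge0 => x _; rewrite lee_fin sqr_ge0.
set M := \int[nu]_(x in D) `|f x|%:E.
have M0 : 0 <= M by apply: integral_ge0 => x _; rewrite lee_fin.
have tE0 : 0 <= t%:E * E by rewrite mule_ge0// lee_fin ltW.
have [Mz|Mn0] := eqVneq M 0; last first.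
  rewrite gt0_mulye; last by rewrite expe_gt0// lt_def Mn0.
  by rewrite addey ?leey// gt_eqF// (lt_le_trans _ tE0).
suff -> : \int[nu]_(x in D) ((f x) ^+ 2)%:E = 0.
  by rewrite Mz expeS mul0e mule0 adde0.
have mEf : measurable_fun D (EFin \o f) by exact/measurable_EFinP.
have f0 := (ae_eq_integral_abs nu mD mEf).1 Mz.
rewrite (ae_eq_integral (cst 0))//; first by rewrite integral0.
  by apply/measurable_EFinP; exact: measurable_funX.
by apply: filterS f0 => x /= + Dx => /(_ Dx) [->]; rewrite expr0n.
Qed.

(** A single inequality bounds betaSP: the function equal to +oo before t and to b
    from t on is admissible. *)
Lemma betaSP_le t b : (0 < t)%R -> (forall f, C f -> measurable_fun D f) ->
  1 <= b -> SP t b -> beta t <= b.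
Proof.
move=> t0 mC b1 SPb; rewrite /betaSP t0.
pose bt s := if (s < t)%R then +oo else b.
apply: ereal_inf_lbound; exists bt; last by rewrite /bt ltxx.
split=> [s s' _ ss'|s _|s s0]; rewrite /bt.
- case: ifPn => // s't; first by rewrite (le_lt_trans ss' s't).
  by case: ifPn => // _; exact: leey.
- by case: ifPn => // _; exact: leey.
- case: ifPn => [_|]; first exact: super_poincare_pinfty.
  rewrite -leNgt => ts f Cf; apply: (le_trans (SPb f Cf)).
  rewrite leeD2r// lee_wpmul2r ?lee_fin//.
  by apply: integral_ge0 => x _; rewrite lee_fin sqr_ge0.
Qed.

End betaSP_facts.

(** * Uniform continuity and Riemann sums *)

Section uniform.
Context {R : realType} {n : nat}.

Lemma continuous_dot (T : topologicalType) (u v : T -> 'rV[R]_n) :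
  (forall i, continuous (fun x => u x 0 i)) ->
  (forall i, continuous (fun x => v x 0 i)) ->
  continuous (fun x => dot (u x) (v x)).
Proof.
move=> cu cv; rewrite /dot.
apply: (@continuous_big R^o _ +%R 0 xpredT (@add_continuous R^o) T _
  (fun i x => u x 0 i * v x 0 i)) => i _ x.
by apply: cvgM; [exact: cu|exact: cv].
Qed.

Lemma compact_sphere : compact (@sphere R n).
Proof.
apply: bounded_closed_compact.
  exists 1; split; first exact: num_real.
  move=> M M1 x /sphere_dot x1; rewrite /Num.Def.normr/= mx_normrE.
  apply: (le_trans _ (ltW M1)); apply: bigmax_le => // -[i j] _ /=.
  rewrite ord1 -(@expr_le1 _ 2)// real_normK ?num_real// -x1 /dot.
  rewrite (bigD1 j)//= -expr2 lerDl; apply: sumr_ge0 => k _.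
  by rewrite -expr2 sqr_ge0.
have -> : @sphere R n = (fun x => dot x x) @^-1` [set 1].
  apply/seteqP; split=> [x /sphere_dot //|x /= x1].
  by rewrite /sphere/= /enorm x1 sqrtr1.
apply: preimage_closed; last exact: closed_eq.
by move=> x _; apply: continuous_dot => i; exact: coord_continuous.
Qed.

(** Uniform continuity on the compact set [0, K] x sphere, in the form needed to
    compare H at a node with H on the cell of that node. *)
Lemma unif_radial (H : R * 'rV[R]_n -> R) (K e : R) : continuous H -> 0 < e ->
  \forall j \near \oo, forall rho theta r, 0 <= rho <= K -> sphere theta ->
    `|r - rho| <= j.+1%:R^-1 -> `|H (r, theta) - H (rho, theta)| <= e.
Proof.
move=> cH e0.
pose A := (`[0, K] : set R) `*` @sphere R n.
have cA : compact A.
  by apply: compact_setX; [exact: segment_compact|exact: compact_sphere].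
pose P j (p : R * 'rV[R]_n) := forall r, `|r - p.1| <= j.+1%:R^-1 ->
  `|H (r, p.2) - H p| <= e.
have : \forall j \near \oo, A `<=` P j.
  move/compact_near_coveringP: cA; apply => -[rho theta] _.
  have e20 : 0 < e / 2 by rewrite divr_gt0.
  have /cvgrPdist_lt/(_ _ e20) := cH (rho, theta).
  move=> /nbhs_ballP[d /= d0 dH].
  have d20 : 0 < d / 2 by rewrite divr_gt0.
  (* the other half of d is left for the step from rho' to r *)
  exists (ball (rho, theta) (d / 2), [set j | j.+1%:R^-1 < d / 2]).
    split; first exact: nbhsx_ballx.
    exact: near_infty_natSinv_lt (PosNum d20).
  move=> [[rho' theta'] j] [/= [b1 b2] jd] r /= rj.
  have b1' : ball (rho, theta) d (rho', theta').
    have dd : d / 2 <= d by move: d0; lra.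
    by split; exact: (le_ball dd).
  have b2' : ball (rho, theta) d (r, theta').
    split; last by have [] := b1'.
    rewrite /= (splitr d); apply: ball_triangle b1 _.
    by rewrite /ball/= distrC (le_lt_trans rj).
  have h1 := dH _ b1'; have h2 := dH _ b2'.
  rewrite -(subrK (H (rho, theta)) (H (r, theta'))) -addrA.
  rewrite (le_trans (ler_normD _ _))// (splitr e) lerD// ?ltW//.
  by rewrite distrC.
by apply: filterS => j AP rho theta r rK st; apply: (AP (rho, theta)).
Qed.

End uniform.

Section riemann.
Context {d : measure_display} {T : measurableType d} {R : realType}.
Variables (nu : probability T R) (D : set T) (m : nat) (I : 'I_m -> set T).
Hypotheses (mD : measurable D) (mI : forall i, measurable (I i)).
Hypothesis tI : trivIset setT I.
Let A := \big[setU/set0]_(i < m) I i.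
Hypothesis AD : A `<=` D.
Let w i := fine (nu (I i)).

Let sumE (a : 'I_m -> R) : ((\sum_(i < m) w i * a i)%:E =
  \sum_(i < m) \int[nu]_(x in I i) (a i)%:E)%E.
Proof.
rewrite -sumEFin; apply: eq_bigr => i _.
by rewrite integral_cst// EFinM muleC fineK// fin_num_measure.
Qed.

Let IA i : I i `<=` A.
Proof.
by move=> x Ix; rewrite /A -bigcup_seq; exists i => //=; rewrite mem_index_enum.
Qed.

Let intA (q : T -> \bar R) : measurable_fun D q -> (forall x, D x -> 0 <= q x)%E ->
  (\int[nu]_(x in A) q x = \sum_(i < m) \int[nu]_(x in I i) q x)%E.
Proof.
move=> mq q0; apply: ge0_integral_bigsetU => //.
- exact: index_enum_uniq.
- by apply: sub_trivIset tI.
- by apply: measurable_funS mq.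
- by move=> x /AD; exact: q0.
Qed.

(** On each cell a_i exceeds q by at most e, and the cells have total mass at
    most 1: the total error is at most e. *)
Lemma riemann_le (a : 'I_m -> R) (q : T -> R) (e : R) : 0 <= e ->
  (forall i, 0 <= a i) -> measurable_fun D q -> (forall x, D x -> 0 <= q x) ->
  (forall i x, I i x -> a i <= q x + e) ->
  ((\sum_(i < m) w i * a i)%:E <= \int[nu]_(x in D) (q x)%:E + e%:E)%E.
Proof.
move=> e0 a0 mq q0 aq; rewrite sumE.
have mqe : measurable_fun D (fun x => (q x + e)%:E).
  by apply/measurable_EFinP; exact: measurable_funD.
have qe0 x : D x -> (0 <= (q x + e)%:E)%E.
  by move=> Dx; rewrite lee_fin addr_ge0// q0.
have mA : measurable A by exact: bigsetU_measurable.
apply: (@le_trans _ _ (\int[nu]_(x in A) (q x + e)%:E)%E).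
  rewrite intA//; apply: lee_sum => i _; apply: ge0_le_integral => //.
  - by move=> x _; rewrite lee_fin.
  - by apply: measurable_funS mqe => // x /IA /AD.
  - by move=> x Ix; rewrite lee_fin aq.
apply: (@le_trans _ _ (\int[nu]_(x in D) (q x + e)%:E)%E).
  exact: ge0_subset_integral.
under eq_integral do rewrite EFinD.
rewrite ge0_integralD//; last exact/measurable_EFinP.
rewrite leeD2l// integral_cst//.
by rewrite -[leRHS]mule1 lee_wpmul2l ?lee_fin ?probability_le1.
Qed.

(** The same error count; the a_i control q on the union of the cells only, which
    is why the integral is restricted to it. *)
Lemma riemann_ge (a : 'I_m -> R) (q : T -> R) (e : R) : 0 <= e ->
  (forall i, 0 <= a i) -> measurable_fun D q -> (forall x, D x -> 0 <= q x) ->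
  (forall i x, I i x -> q x <= a i + e) ->
  (\int[nu]_(x in A) (q x)%:E <= (\sum_(i < m) w i * a i + e)%:E)%E.
Proof.
move=> e0 a0 mq q0 qa.
rewrite intA; [|exact/measurable_EFinP|by move=> x Dx; rewrite lee_fin q0].
apply: (@le_trans _ _ (\sum_(i < m) \int[nu]_(x in I i) (a i + e)%:E)%E).
  apply: lee_sum => i _; apply: ge0_le_integral => //.
  - by move=> x /IA/AD Dx; rewrite lee_fin q0.
  - by apply/measurable_EFinP; apply: measurable_funS mq => // x /IA /AD.
  - by move=> x Ix; rewrite lee_fin qa.
rewrite -sumE EFinD.
under eq_bigr do rewrite mulrDr.
rewrite big_split/= EFinD leeD2l// -mulr_suml lee_fin ler_piMl//.
rewrite -lee_fin.
have -> : (\sum_(i < m) w i)%:E = nu A.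
  rewrite -[RHS]mul1e -integral_cst//; last exact: bigsetU_measurable.
  rewrite intA//.
  under [RHS]eq_bigr do rewrite integral_cst// mul1e.
  by rewrite -sumEFin; apply: eq_bigr => i _; rewrite fineK// fin_num_measure.
exact: probability_le1 (bigsetU_measurable _ _).
Qed.

End riemann.

(** * Meshes of the half-line and integration in polar coordinates *)

Section cells.
Context {R : realType} (K j : nat).

(** The mesh of [0, K[ with step 1 / (j + 1).  Each node is the left end of its
    cell, so that the sum of the w_i node_i^2 stays below the second moment. *)
Definition node (i : 'I_(K * j.+1)) : R := i%:R / j.+1%:R.

Definition cell (i : 'I_(K * j.+1)) : set R :=
  `[node i, node i + j.+1%:R^-1[%classic.

Lemma cellE i (x : R) : cell i x <-> i%:R <= x * j.+1%:R < i.+1%:R.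
Proof.
rewrite /cell/= in_itv/= /node -[X in _ < _ + X]mul1r -mulrDl.
by rewrite ler_pdivrMr// ltr_pdivlMr// natr1.
Qed.

Lemma cell_trivIset : trivIset setT cell.
Proof.
move=> i i' _ _ [x [/cellE /andP[a b] /cellE /andP[a' b']]]; apply/val_inj.
have := le_lt_trans a b'; have := le_lt_trans a' b.
rewrite !ltr_nat !ltnS => h1 h2.
by apply/eqP; rewrite eqn_leq h1 h2.
Qed.

Lemma bigcup_cell : \big[setU/set0]_(i < K * j.+1) cell i = `[0, K%:R[%classic.
Proof.
rewrite -bigcup_seq; apply/seteqP; split=> [x [i _ /cellE/andP[a b]]|x /=].
  have j0 : 0 < j.+1%:R :> R by [].
  rewrite /= in_itv/= -(pmulr_lge0 x j0) (le_trans _ a)//=.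
  by rewrite -(ltr_pM2r j0) (lt_le_trans b)// -natrM ler_nat.
rewrite in_itv/= => /andP[x0 xK].
have xj0 : 0 <= x * j.+1%:R by rewrite mulr_ge0.
have xt := truncn_itv xj0.
have ltK : (Num.truncn (x * j.+1%:R) < K * j.+1)%N.
  rewrite -(ltr_nat R) (le_lt_trans (andP xt).1)// natrM ltr_pM2r//.
exists (Ordinal ltK); first by rewrite /= mem_index_enum.
exact/cellE.
Qed.

Lemma node_ge0 i : 0 <= node i.
Proof. by rewrite /node divr_ge0. Qed.

Lemma cell_node i (x : R) : cell i x ->
  [/\ node i <= x, 0 <= x <= K%:R & `|node i - x| <= j.+1%:R^-1].
Proof.
move=> xi; have : `[0, K%:R[%classic x.
  by rewrite -bigcup_cell -bigcup_seq; exists i => //=; rewrite mem_index_enum.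
rewrite /= in_itv/= => /andP[x0 xK].
move: xi; rewrite /cell/= in_itv/= => /andP[a b].
split=> //; first by rewrite x0 ltW.
by rewrite distrC ger0_norm ?subr_ge0// lerBlDl ltW.
Qed.

End cells.

Section carried.
Context {d : measure_display} {T : measurableType d} {R : realType}.
Variables (nu : probability T R) (D : set T).
Hypotheses (mD : measurable D) (nuD : nu (~` D) = 0%E).
Local Open Scope ereal_scope.

Lemma integral_carried (q : T -> \bar R) : measurable_fun setT q ->
  (forall x, 0 <= q x) -> \int[nu]_x q x = \int[nu]_(x in D) q x.
Proof.
move=> mq q0.
have disjD : [disjoint D & ~` D]%classic by apply/disj_setPRL.
rewrite -[in LHS](setUv D) ge0_integral_setU ?setUv//; last exact: measurableC.
rewrite -[RHS]adde0; congr (_ + _).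
rewrite -(integral_abs_eq0 (measurableC mD) (measurable_funTS mq) nuD).
by apply: eq_integral => x _; rewrite gee0_abs.
Qed.

End carried.

Section polar_integration.
Context {R : realType} {n : nat}.
Variables (mur : probability (measurableTypeR R) R).
Variables (mua mu : probability (Rn R n) R).
Notation S := (@sphere R n : set (Rn R n)).
Notation D := (@halfline R : set (measurableTypeR R)).
Local Open Scope ereal_scope.

Section inner.
Variable H : measurableTypeR R * Rn R n -> R.
Hypotheses (mH : measurable_fun setT H) (H0 : forall p, (0 <= H p)%R).

Lemma measurable_slice theta :
  measurable_fun setT (fun rho : measurableTypeR R => H (rho, theta)).
Proof. by apply: measurableT_comp => //; exact: pair2_measurable. Qed.

Lemma measurable_inner_integral (A : set (measurableTypeR R)) : measurable A ->
  measurable_fun setT (fun theta => \int[mur]_(rho in A) (H (rho, theta))%:E).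
Proof.
move=> mA; pose HA := (fun p => (H p)%:E) \_ (A `*` setT).
have mHA : measurable_fun setT HA.
  apply/(measurable_restrictT _ _).1; first exact: measurableX.
  by apply: measurable_funTS; exact/measurable_EFinP.
have HA0 p : 0 <= HA p.
  by rewrite /HA patchE; case: ifP => // _; rewrite lee_fin.
have := @measurable_fun_fubini_tonelli_G _ _ _ _ _ mur _ mHA HA0.
congr measurable_fun; apply/funext => theta; rewrite /fubini_G [RHS]integral_mkcond.
apply: eq_integral => rho _; rewrite /HA !patchE.
by congr (if _ then _ else _); apply/idP/idP; rewrite !inE//= => -[].
Qed.

Lemma inner_integral_ge0 (A : set (measurableTypeR R)) theta :
  0 <= \int[mur]_(rho in A) (H (rho, theta))%:E.
Proof. by apply: integral_ge0 => rho _; rewrite lee_fin. Qed.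

(** Monotone convergence, twice: for the inner integral and for its square. *)
Lemma integral_sq_truncated (b : \bar R) :
  (forall K : nat, \int[mua]_(theta in S)
    (\int[mur]_(rho in `[0%R, K%:R[) (H (rho, theta))%:E) ^+ 2 <= b) ->
  \int[mua]_(theta in S) (\int[mur]_(rho in D) (H (rho, theta))%:E) ^+ 2 <= b.
Proof.
move=> hK.
pose A K : set (measurableTypeR R) := `[0%R, K%:R[%classic.
have mA K : measurable (A K) by exact: measurable_itv.
pose g K theta := \int[mur]_(rho in A K) (H (rho, theta))%:E.
have mHs theta B : measurable_fun B (fun rho => (H (rho, theta))%:E).
  by apply: measurable_funTS; apply/measurable_EFinP; exact: measurable_slice.
have ndA : {homo A : k m / (k <= m)%N >-> (k <= m)%O}.
  move=> k m km; rewrite subsetEset => x; rewrite /A/= !in_itv/=.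
  by move=> /andP[-> /lt_le_trans]; apply; rewrite ler_nat.
have AD : \bigcup_K A K = D.
  apply/seteqP; split=> [x [K _]|x]; rewrite /A /halfline/= !in_itv/=.
    by move=> /andP[->].
  rewrite andbT => x0; exists (Num.truncn x).+1 => //=.
  by rewrite in_itv/= x0; have /andP[] := truncn_itv x0.
have nd theta : {homo g ^~ theta : k m / (k <= m)%N >-> k <= m}.
  move=> k m km; apply: ge0_subset_integral => //.
  - by move=> x _; rewrite lee_fin.
  - by rewrite -subsetEset; exact: ndA.
have cg theta : g K theta @[K --> \oo] -->
    \int[mur]_(rho in D) (H (rho, theta))%:E.
  rewrite -AD; apply: ge0_nondecreasing_set_cvg_integral => // K x _.
  by rewrite lee_fin.
have cg2 theta : (g K theta) ^+ 2 @[K --> \oo] -->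
    (\int[mur]_(rho in D) (H (rho, theta))%:E) ^+ 2.
  rewrite expe2; under eq_fun do rewrite expe2.
  apply: cvgeM; [|exact: cg|exact: cg].
  by rewrite mule_defE orbb; case: (_ =P 0) => [->|//]; rewrite abse0.
have := @cvg_monotone_convergence _ _ _ mua S measurable_sphere
  (fun K theta => (g K theta) ^+ 2).
have -> : \int[mua]_(x in S) limn (fun K => g K x ^+ 2) =
    \int[mua]_(theta in S) (\int[mur]_(rho in D) (H (rho, theta))%:E) ^+ 2.
  by apply: eq_integral => theta _; exact/cvg_lim/cg2.
move=> cv; apply: (cvge_le _ (cv _ _ _)).
- by near=> K; exact: hK.
- move=> K; under eq_fun do rewrite expe2.
  by apply: emeasurable_funM; apply: measurable_funTS;
     exact: measurable_inner_integral.
- by move=> K theta _; exact: sqre_ge0.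
- move=> theta _ k m km; rewrite lee_sqr ?nd//; exact: inner_integral_ge0.
Unshelve. all: by end_near. Qed.

End inner.

Hypotheses (murD : mur (~` D) = 0) (muaS : mua (~` S) = 0).
Hypothesis muE : forall A : set (Rn R n), measurable A ->
  mu A = (mur \x mua) ((@polar R n) @^-1` A).

Lemma polar_integral (q : 'rV[R]_n -> R) :
  measurable_fun setT (q : Rn R n -> R) -> (forall x, (0 <= q x)%R) ->
  \int[mu]_x (q x)%:E =
  \int[mua]_(theta in S) \int[mur]_(rho in D) (q (rho *: theta))%:E.
Proof.
move=> mq q0.
pose H (p : measurableTypeR R * Rn R n) := q (polar p).
have mH : measurable_fun setT H by exact: measurableT_comp measurable_polar.
have H0 p : (0 <= H p)%R by exact: q0.
have mEH : measurable_fun setT (EFin \o H) by exact/measurable_EFinP.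
have -> : \int[mu]_x (q x)%:E =
    \int[pushforward (mur \x mua) (polar : _ -> Rn R n)]_x (q x)%:E.
  apply: eq_measure_integral => [|mpolar A mA _]; last exact: muE.
  exact: measurable_polar.
rewrite ge0_integral_pushforward//; last 3 first.
- exact: measurable_polar.
- exact/measurable_EFinP.
- by move=> x _; rewrite lee_fin.
rewrite preimage_setT (fubini_tonelli2 (EFin \o H))//.
rewrite (integral_carried measurable_sphere muaS); last 2 first.
- exact: measurable_fun_fubini_tonelli_G.
- by move=> theta; apply: integral_ge0 => x _; exact: H0.
apply: eq_integral => theta _.
apply: (integral_carried measurable_halfline murD) => [|x]; last exact: H0.
by apply/measurable_EFinP; exact: (measurable_slice mH).
Qed.

End polar_integration.

(** * Radial and tangential energies *)

Section radial_integrand.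
Context {R : realType} {n : nat}.
Variable f : 'rV[R]_n -> R.
Hypothesis sf : smooth_on setT f.
Notation P := (measurableTypeR R * Rn R n)%type.

(** At (rho, theta) with theta a unit vector, tang_energy and rad_energy add up to
    the squared gradient of f at rho theta. *)
Definition tang_energy (p : R * 'rV[R]_n) : R :=
  enorm (tproj (grad f (p.1 *: p.2)) p.2) ^+ 2.

Definition rad_energy (p : R * 'rV[R]_n) : R :=
  dot (grad f (p.1 *: p.2)) p.2 ^+ 2.

Lemma continuous_along_rays (g : 'rV[R]_n -> R) : continuous g ->
  continuous (fun p : R * 'rV[R]_n => g (p.1 *: p.2)).
Proof.
move=> cg p.
apply: (@continuous_comp _ _ _ (fun p : R * 'rV[R]_n => p.1 *: p.2) g).
  exact: scale_continuous.
exact: cg.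
Qed.

Lemma continuous_tang_energy : continuous tang_energy.
Proof.
have cg i : continuous (fun p : R * 'rV[R]_n => grad f (p.1 *: p.2) 0 i).
  exact: continuous_along_rays (smooth_grad_continuous (i := i) sf).
have c2 i : continuous (fun p : R * 'rV[R]_n => p.2 0 i).
  move=> p; apply: (@continuous_comp _ _ _ snd (fun x : 'rV[R]_n => x 0 i)).
    exact: cvg_snd.
  exact: coord_continuous.
have -> : tang_energy = fun p => dot (tproj (grad f (p.1 *: p.2)) p.2)
    (tproj (grad f (p.1 *: p.2)) p.2).
  by apply/funext => p; rewrite /tang_energy enorm_sq.
have cp i : continuous (fun p : R * 'rV[R]_n =>
    tproj (grad f (p.1 *: p.2)) p.2 0 i).
  have -> : (fun p : R * 'rV[R]_n => tproj (grad f (p.1 *: p.2)) p.2 0 i) =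
    (fun p => grad f (p.1 *: p.2) 0 i - dot (grad f (p.1 *: p.2)) p.2 * p.2 0 i).
    by apply/funext => p; rewrite !mxE.
  have cd := continuous_dot cg c2.
  by move=> p; apply: cvgB; [exact: cg|apply: cvgM; [exact: cd|exact: c2]].
exact (continuous_dot cp cp).
Qed.

Lemma measurable_along_rays (g : 'rV[R]_n -> R) :
  measurable_fun setT (g : Rn R n -> R) ->
  measurable_fun setT (fun p : P => g ((p.1 : R) *: (p.2 : 'rV[R]_n))).
Proof. by move=> mg; exact: measurableT_comp mg measurable_polar. Qed.

Lemma measurable_dot d (T : measurableType d) (u v : T -> 'rV[R]_n) :
  (forall i, measurable_fun setT (fun x => u x 0 i)) ->
  (forall i, measurable_fun setT (fun x => v x 0 i)) ->
  measurable_fun setT (fun x => dot (u x) (v x)).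
Proof.
move=> mu mv; apply: measurable_sum => i; exact: measurable_funM.
Qed.

Lemma measurable_grad (g : 'rV[R]_n -> R) i : smooth_on setT g ->
  measurable_fun setT ((fun x => grad g x 0 i) : Rn R n -> R).
Proof.
by move=> sg; apply: measurable_Rn_continuous; exact: smooth_grad_continuous.
Qed.

Let mgr i : measurable_fun setT
  (fun p : P => grad f ((p.1 : R) *: (p.2 : 'rV[R]_n)) 0 i).
Proof. exact: (measurable_along_rays (measurable_grad i sf)). Qed.

Let m2 i : measurable_fun setT (fun p : P => (p.2 : 'rV[R]_n) 0 i).
Proof. exact: measurableT_comp (measurable_coord i) measurable_snd. Qed.

Lemma measurable_tproj_sq d (T : measurableType d) (u v : T -> 'rV[R]_n) :
  (forall i, measurable_fun setT (fun x => u x 0 i)) ->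
  (forall i, measurable_fun setT (fun x => v x 0 i)) ->
  measurable_fun setT (fun x => enorm (tproj (u x) (v x)) ^+ 2).
Proof.
move=> mu mv; under eq_fun do rewrite enorm_sq.
have mt i : measurable_fun setT (fun x => tproj (u x) (v x) 0 i).
  under eq_fun do rewrite !mxE.
  apply: measurable_funB => //.
  by apply: measurable_funM => //; exact: measurable_dot.
exact: measurable_dot.
Qed.

Lemma measurable_tang_energy : measurable_fun setT (tang_energy : P -> R).
Proof. exact: measurable_tproj_sq. Qed.

Lemma measurable_rad_energy : measurable_fun setT (rad_energy : P -> R).
Proof. by apply: measurable_funX; exact: measurable_dot. Qed.

Lemma smooth_measurable : measurable_fun setT (f : Rn R n -> R).
Proof. exact: measurable_Rn_continuous (smooth_continuous sf). Qed.

End radial_integrand.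

(** * The spherical inequality for the radial average *)

Section ereal_limit.
Context {R : realType}.
Local Open Scope ereal_scope.

(** Letting e tend to 0.  For e <= 1 the finite error is at most
    e (c + b (6 z + 9)); if y or z is infinite, so is the bound. *)
Lemma le_quadratic_perturbation (x y z : \bar R) (c b : R) :
  (0 < c)%R -> (0 < b)%R -> 0 <= y -> 0 <= z ->
  (forall e : R, (0 < e)%R ->
    x <= c%:E * (y + e%:E) + b%:E * (z + (3 * e)%:E) ^+ 2) ->
  x <= c%:E * y + b%:E * z ^+ 2.
Proof.
move=> c0 b0; case: y => [y| |//] y0; last first.
  move=> _ _; rewrite gt0_muley ?lte_fin// addye ?leey// gt_eqF//.
  by rewrite (lt_le_trans ltNy0)// mule_ge0 ?sqre_ge0// lee_fin ltW.
case: z => [z| |//] z0; last first.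
  move=> _; rewrite expe2 mulyy gt0_muley ?lte_fin// addey ?leey//.
rewrite !lee_fin in y0 z0 *.
move=> H; apply/lee_addgt0Pr => d d0.
pose k := (c + b * (6 * z + 9))%R.
have k0 : (0 < k)%R by rewrite addr_gt0// mulr_gt0// ltr_wpDl// mulr_ge0.
pose e := Num.min 1%R (d / k)%R.
have e0 : (0 < e)%R by rewrite lt_min ltr01 divr_gt0.
have e1 : (e <= 1)%R by rewrite ge_min lexx.
have ek : (k * e <= d)%R.
  by rewrite mulrC -ler_pdivlMr// ge_min lexx orbT.
apply: (le_trans (H e e0)).
rewrite -!EFinD lee_fin -!expr2.
have ee : (e ^+ 2 <= e)%R by rewrite expr2 ler_piMl// ltW.
have be : (b * e ^+ 2 <= b * e)%R by rewrite ler_wpM2l// ltW.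
move: ek be; rewrite /k; set E := (e ^+ 2)%R => ek be.
have -> : (c * (y + e) + b * (z + 3 * e) ^+ 2 =
  c * y + b * z ^+ 2 + (c * e + b * (6 * z) * e + 9 * (b * E)))%R.
  by rewrite /E; ring.
rewrite lerD2l (le_trans _ ek)//.
have -> : ((c + b * (6 * z + 9)) * e = c * e + b * (6 * z) * e + 9 * (b * e))%R.
  by ring.
by rewrite lerD2l ler_wpM2l.
Qed.

End ereal_limit.

Section tangential.
Context {R : realType} {n : nat}.
Variables (mur : probability (measurableTypeR R) R).
Variable mua : probability (Rn R n) R.
Notation S := (@sphere R n : set (Rn R n)).
Notation D := (@halfline R : set (measurableTypeR R)).
Variables (s b m2 : R).
Hypotheses (s0 : 0 < s) (b1 : 1 <= b) (m20 : 0 < m2).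
Hypothesis m2E : (\int[mur]_(rho in D) (rho ^+ 2)%:E = m2%:E)%E.
Hypothesis spa : super_poincare mua S (@smooth_near R 'rV[R]_n (@sphere R n))
  (fun f x => enorm (tgrad f x)) s b%:E.
Variable f : 'rV[R]_n -> R.
Hypothesis sf : smooth_on setT f.

Let F (p : measurableTypeR R * Rn R n) : R :=
  `|f ((p.1 : R) *: (p.2 : 'rV[R]_n))|.

Let mF : measurable_fun setT F.
Proof.
apply: measurableT_comp => //.
exact: measurable_along_rays (smooth_measurable sf).
Qed.

Let F0 p : 0 <= F p. Proof. exact: normr_ge0. Qed.

Let T0 (p : measurableTypeR R * Rn R n) : 0 <= tang_energy f p.
Proof. exact: sqr_ge0. Qed.

Let TE := (\int[mua]_(theta in S) \int[mur]_(rho in D)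
  (tang_energy f (rho, theta))%:E)%E.
Let L1 := (\int[mua]_(theta in S) \int[mur]_(rho in D) (F (rho, theta))%:E)%E.

Let mS : measurable S := measurable_sphere.
Let mD : measurable D := measurable_halfline.

Section mesh.
Variables (K j : nat) (e : R).
Hypothesis e0 : 0 < e.
Let m := (K * j.+1)%N.
Let r : 'I_m -> R := @node R K j.
Let I : 'I_m -> set R := @cell R K j.
Let w i := fine (mur (I i)).
Let G := ray_sum f w r e.

Let w0 i : 0 <= w i. Proof. by rewrite fine_ge0. Qed.

Let mI i : measurable (I i : set (measurableTypeR R)).
Proof. exact: measurable_itv. Qed.

Let tI : trivIset setT I. Proof. exact: cell_trivIset. Qed.

Let ID : \big[setU/set0]_(i < m) I i `<=` D.
Proof.
rewrite bigcup_cell => x; rewrite /halfline/= !in_itv/= => /andP[-> _] //.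
Qed.

Let mFs theta (A : set (measurableTypeR R)) :
  measurable_fun A (fun rho : measurableTypeR R => F (rho, theta)).
Proof. by apply: measurable_funTS; exact: measurable_slice. Qed.

Let mTs theta (A : set (measurableTypeR R)) :
  measurable_fun A (fun rho : measurableTypeR R => tang_energy f (rho, theta)).
Proof.
apply: measurable_funTS.
exact: (@measurable_slice R n (tang_energy f) (measurable_tang_energy sf)).
Qed.

Hypothesis meshF : forall rho theta t, 0 <= rho <= K%:R -> sphere theta ->
  `|t - rho| <= j.+1%:R^-1 ->
  `|f (t *: theta) - f (rho *: theta)| <= e.
Hypothesis meshT : forall rho theta t, 0 <= rho <= K%:R -> sphere theta ->
  `|t - rho| <= j.+1%:R^-1 ->
  `|tang_energy f (t, theta) - tang_energy f (rho, theta)| <= e.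

Let G_ge theta : sphere theta ->
  (\int[mur]_(rho in `[0%R, K%:R[) (F (rho, theta))%:E <= (G theta)%:E)%E.
Proof.
move=> st; rewrite -(bigcup_cell K j) /G /ray_sum.
apply: (riemann_ge mur mD mI tI ID) => //; first exact: ltW.
  by move=> i; exact/ltW/smooth_abs_gt0.
move=> i x xi; have [_ xK nx] := cell_node xi.
rewrite (le_trans _ (lerD (le_abs_smooth_abs e0 _) (lexx _)))// addrC -lerBlDr.
by rewrite (le_trans (lerB_dist _ _))// distrC; exact: meshF.
Qed.

Let G_le theta : sphere theta ->
  ((G theta)%:E <= \int[mur]_(rho in D) (F (rho, theta))%:E + (3 * e)%:E)%E.
Proof.
move=> st; rewrite /G /ray_sum.
have -> : 3 * e = 2 * e + e by ring.
rewrite !EFinD addeA leeD2r//.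
apply: (riemann_le mur mD mI tI ID) => //; first by rewrite mulr_ge0// ltW.
  by move=> i; exact/ltW/smooth_abs_gt0.
move=> i x xi; have [_ xK nx] := cell_node xi.
rewrite (le_trans (smooth_abs_le e0 _))// mulr_natl mulr2n addrA lerD2r.
rewrite addrC -lerBlDr.
by rewrite (le_trans (lerB_dist _ _))//; exact: meshF.
Qed.

Let tgrad_le theta : sphere theta ->
  ((enorm (tgrad G theta) ^+ 2)%:E <=
   m2%:E * (\int[mur]_(rho in D) (tang_energy f (rho, theta))%:E + e%:E))%E.
Proof.
move=> st.
have W2 : \sum_(i < m) w i * r i ^+ 2 <= m2.
  rewrite -lee_fin -m2E -[leRHS]adde0.
  apply: (riemann_le mur mD mI tI ID) => //.
  - by move=> i; exact: sqr_ge0.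
  - by move=> x _; exact: sqr_ge0.
  - move=> i x xi; have [nx /andP[x0 _] _] := cell_node xi.
    by rewrite addr0 ler_pXn2r// ?nnegrE ?node_ge0.
apply: (@le_trans _ _ (m2 * \sum_(i < m) w i * tang_energy f (r i, theta))%:E).
  rewrite lee_fin (le_trans (tgrad_ray_sum_le sf r w0 e0 theta))// ler_wpM2r//.
  by apply: sumr_ge0 => i _; rewrite mulr_ge0// sqr_ge0.
rewrite EFinM lee_wpmul2l ?lee_fin ?(ltW m20)//.
apply: (riemann_le mur mD mI tI ID) => //; first exact: ltW.
move=> i x xi; have [_ xK nx] := cell_node xi.
rewrite addrC -lerBlDr (le_trans (ler_norm _))//.
exact: meshT.
Qed.

Let smG : smooth_on setT G. Proof. exact: smooth_ray_sum. Qed.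

Let G0 theta : 0 <= G theta.
Proof.
rewrite /G /ray_sum addr_ge0 ?(ltW e0)//; apply: sumr_ge0 => i _.
by rewrite mulr_ge0// ltW// smooth_abs_gt0.
Qed.

(** The spherical inequality applied to ray_sum, an admissible test function.
    One e comes from the smoothing, one from the mesh and one from the constant
    in ray_sum, hence 3 e. *)
Lemma mesh_super_poincare :
  (\int[mua]_(theta in S)
     (\int[mur]_(rho in `[0%R, K%:R[) (F (rho, theta))%:E) ^+ 2 <=
   (s * m2)%:E * (TE + e%:E) + b%:E * (L1 + (3 * e)%:E) ^+ 2)%E.
Proof.
have mG : measurable_fun S (G : Rn R n -> R).
  by apply: measurable_funTS; exact: smooth_measurable.
have muaS1 : (forall c : R, (0 <= c)%R -> \int[mua]_(theta in S) c%:E <= c%:E)%E.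
  move=> c c0; rewrite integral_cst//.
  by rewrite -[leRHS]mule1 lee_wpmul2l ?lee_fin// probability_le1.
have mC : measurable_fun S (fun theta =>
    \int[mur]_(rho in D) (tang_energy f (rho, theta))%:E)%E.
  apply: measurable_funTS; apply: measurable_inner_integral => //.
  exact: measurable_tang_energy.
have mg (A : set (measurableTypeR R)) : measurable A ->
    measurable_fun S (fun theta => \int[mur]_(rho in A) (F (rho, theta))%:E)%E.
  by move=> mA; apply: measurable_funTS; exact: measurable_inner_integral.
have C0 theta : (0 <= \int[mur]_(rho in D) (tang_energy f (rho, theta))%:E)%E.
  exact: inner_integral_ge0.
have g0 theta : (0 <= \int[mur]_(rho in D) (F (rho, theta))%:E)%E.
  exact: inner_integral_ge0.
apply: (@le_trans _ _ (\int[mua]_(theta in S) ((G theta) ^+ 2)%:E)%E).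
  apply: ge0_le_integral => //.
  - by move=> theta _; exact: sqre_ge0.
  - under eq_fun do rewrite expe2.
    by apply: emeasurable_funM; apply: mg; exact: measurable_itv.
  - by apply/measurable_EFinP; exact: measurable_funX.
  - move=> theta st; rewrite EFin_expe lee_sqr ?G_ge//.
    + exact: inner_integral_ge0.
    + by rewrite lee_fin.
have nG : smooth_near (@sphere R n) G.
  by exists setT; split=> //; exact: openT.
apply: (le_trans (spa nG)); apply: leeD.
  rewrite EFinM -muleA lee_wpmul2l ?lee_fin ?(ltW s0)//.
  apply: (@le_trans _ _ (\int[mua]_(theta in S)
    (m2%:E * (\int[mur]_(rho in D) (tang_energy f (rho, theta))%:E + e%:E)))%E).
    apply: ge0_le_integral => //.
    - by move=> theta _; rewrite lee_fin sqr_ge0.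
    - apply/measurable_EFinP; apply: measurable_funTS; apply: measurable_tproj_sq.
        by move=> i; exact: measurable_grad.
      exact: measurable_coord.
    - by apply: measurable_funeM; apply: emeasurable_funD.
  rewrite ge0_integralZl//; last 3 first.
  - exact: emeasurable_funD.
  - by move=> theta _; rewrite adde_ge0// lee_fin ltW.
  - by rewrite lee_fin ltW.
  rewrite lee_wpmul2l ?lee_fin ?(ltW m20)//.
  rewrite ge0_integralD//; last by move=> theta _; rewrite lee_fin ltW.
  by rewrite leeD2l// muaS1// ltW.
rewrite lee_wpmul2l ?lee_fin ?(le_trans ler01 b1)//.
rewrite lee_sqr; last 2 first.
- by apply: integral_ge0 => x _; rewrite lee_fin.
- apply: adde_ge0; last by rewrite lee_fin mulr_ge0// ltW.
  by apply: integral_ge0 => x _; exact: g0.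
apply: (@le_trans _ _ (\int[mua]_(theta in S)
    (\int[mur]_(rho in D) (F (rho, theta))%:E + (3 * e)%:E))%E).
  apply: ge0_le_integral => //.
  - apply/measurable_EFinP; exact: (measurableT_comp (@normr_measurable R setT) mG).
  - by apply: emeasurable_funD => //; exact: mg.
  - by move=> theta st; rewrite ger0_norm// G_le.
have e3 : 0 <= 3 * e by rewrite mulr_ge0// ltW.
rewrite ge0_integralD//; last 2 first.
- by move=> theta _; exact: g0.
- exact: mg.
by rewrite leeD2l// muaS1.
Qed.

End mesh.

(** The spherical inequality for g(theta), the integral of |f (rho theta)| over
    rho, which is in general neither smooth nor bounded, and which the
    spherical inequality therefore does not cover directly.  The energy of g is
    replaced by its bound: the second moment times the tangential energy. *)
Lemma tangential_super_poincare :
  (\int[mua]_(theta in S) (\int[mur]_(rho in D) (F (rho, theta))%:E) ^+ 2 <=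
   (s * m2)%:E * TE + b%:E * L1 ^+ 2)%E.
Proof.
apply: integral_sq_truncated => // K.
apply: le_quadratic_perturbation.
- exact: mulr_gt0.
- exact: lt_le_trans b1.
- by apply: integral_ge0 => theta _; exact: inner_integral_ge0.
- by apply: integral_ge0 => theta _; exact: inner_integral_ge0.
move=> e e0.
have cf := continuous_along_rays (smooth_continuous sf).
have cT := continuous_tang_energy sf.
have [j [h1 h2]] := filter_ex
  (filterI (unif_radial K%:R cf e0) (unif_radial K%:R cT e0)).
exact: (@mesh_super_poincare K j).
Qed.

End tangential.

(** * The product bound *)

Section product_bound.
Context {R : realType} {n : nat}.
Variables (mur : probability (measurableTypeR R) R).
Variables (mua mu : probability (Rn R n) R).
Notation S := (@sphere R n : set (Rn R n)).
Notation D := (@halfline R : set (measurableTypeR R)).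
Hypotheses (murD : mur (~` D) = 0%E) (muaS : mua (~` S) = 0%E).
Hypothesis muE : forall A : set (Rn R n), measurable A ->
  mu A = (mur \x mua)%E ((@polar R n) @^-1` A).

Lemma second_moment_polar :
  (\int[mu]_x ((enorm x) ^+ 2)%:E = \int[mur]_(rho in D) (rho ^+ 2)%:E)%E.
Proof.
have mq : measurable_fun setT ((fun x => enorm x ^+ 2) : Rn R n -> R).
  under eq_fun do rewrite enorm_sq.
  by apply: measurable_dot => i; exact: measurable_coord.
rewrite (polar_integral murD muaS muE mq)//; last by move=> x; exact: sqr_ge0.
transitivity (\int[mua]_(theta in S) \int[mur]_(rho in D) (rho ^+ 2)%:E)%E.
  apply: eq_integral => theta; rewrite inE => st.
  apply: eq_integral => rho _; congr (_%:E).
  by rewrite enorm_sq dotZl dotC dotZl (sphere_dot st) mulr1 expr2.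
rewrite -(integral_carried measurable_sphere muaS)//.
  rewrite integral_cst// -[RHS]mule1; congr (_ * _)%E.
  exact: probability_setT.
by move=> theta; apply: integral_ge0 => rho _; rewrite lee_fin sqr_ge0.
Qed.

Variables (t b br m2 : R).
Hypotheses (t0 : 0 < t) (b1 : 1 <= b) (br1 : 1 <= br) (m20 : 0 < m2).
Hypothesis m2E : (\int[mur]_(rho in D) (rho ^+ 2)%:E = m2%:E)%E.
Hypothesis spr : super_poincare mur D (@smooth_near R R^o (@halfline R))
  (fun f x => `|derive1 (f : R -> R) x|) (t / 2) br%:E.
Hypothesis spa : super_poincare mua S (@smooth_near R 'rV[R]_n (@sphere R n))
  (fun f x => enorm (tgrad f x)) (t / (2 * m2 * br)) b%:E.

(** Both inequalities contribute with the factor t / 2: directly in the radial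
    one, and as br * (t / (2 m2 br)) * m2 in the tangential one.  By Pythagoras
    the two energies add up to the full one. *)
Lemma polar_super_poincare :
  super_poincare mu setT (@smooth_on R 'rV[R]_n setT)
    (fun f x => enorm (grad f x)) t (br * b)%:E.
Proof.
move=> f sf.
have mf := smooth_measurable sf.
have br0 : 0 < br := lt_le_trans ltr01 br1.
have mS := @measurable_sphere R n.
have mD := @measurable_halfline R.
have mq2 : measurable_fun setT ((fun x => f x ^+ 2) : Rn R n -> R).
  exact: measurable_funX.
have mqa : measurable_fun setT ((fun x => `|f x|) : Rn R n -> R).
  exact: measurableT_comp.
have mqg : measurable_fun setT ((fun x => enorm (grad f x) ^+ 2) : Rn R n -> R).
  under eq_fun do rewrite enorm_sq.
  by apply: measurable_dot => i; exact: measurable_grad.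
rewrite !(polar_integral murD muaS muE)//; last 2 first.
- by move=> x; exact: sqr_ge0.
- by move=> x; exact: sqr_ge0.
set L1 := (\int[mua]_(theta in S) \int[mur]_(rho in D) `|f (rho *: theta)|%:E)%E.
pose F (p : measurableTypeR R * Rn R n) : R :=
  `|f ((p.1 : R) *: (p.2 : 'rV[R]_n))|.
have mF : measurable_fun setT F by exact: measurable_along_rays mqa.
have F0 p : 0 <= F p by exact: normr_ge0.
have T0 p : 0 <= tang_energy f p by exact: sqr_ge0.
have Q0 p : 0 <= rad_energy f p by exact: sqr_ge0.
have mT := measurable_tang_energy sf.
have mQ := measurable_rad_energy sf.
pose g theta := (\int[mur]_(rho in D) (F (rho, theta))%:E)%E.
pose B theta := (\int[mur]_(rho in D) (rad_energy f (rho, theta))%:E)%E.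
pose C theta := (\int[mur]_(rho in D) (tang_energy f (rho, theta))%:E)%E.
have mB : measurable_fun S B.
  by apply: measurable_funTS; exact: measurable_inner_integral.
have mC : measurable_fun S C.
  by apply: measurable_funTS; exact: measurable_inner_integral.
have mg2 : measurable_fun S (fun theta => g theta ^+ 2)%E.
  under eq_fun do rewrite expe2.
  by apply: emeasurable_funM; apply: measurable_funTS;
     exact: measurable_inner_integral.
have B0 theta : (0 <= B theta)%E by exact: inner_integral_ge0.
have C0 theta : (0 <= C theta)%E by exact: inner_integral_ge0.
have g20 theta : (0 <= g theta ^+ 2)%E by exact: sqre_ge0.
have t20 : 0 < t / 2 by rewrite divr_gt0.
have energyE : (\int[mua]_(theta in S) \int[mur]_(rho in D)
    (enorm (grad f (rho *: theta)) ^+ 2)%:E =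
    \int[mua]_(theta in S) B theta + \int[mua]_(theta in S) C theta)%E.
  rewrite -ge0_integralD//; apply: eq_integral => theta; rewrite inE => st.
  rewrite /B /C -ge0_integralD//; last 4 first.
  - by move=> rho _; rewrite lee_fin Q0.
  - apply/measurable_EFinP; apply: measurable_funTS.
    exact: (@measurable_slice R n (rad_energy f) mQ).
  - by move=> rho _; rewrite lee_fin T0.
  - apply/measurable_EFinP; apply: measurable_funTS.
    exact: (@measurable_slice R n (tang_energy f) mT).
  apply: eq_integral => rho _; rewrite -EFinD; congr (_%:E).
  exact/pythagoras/sphere_dot.
have radial : (\int[mua]_(theta in S) \int[mur]_(rho in D)
      (f (rho *: theta) ^+ 2)%:E <=
    (t / 2)%:E * \int[mua]_(theta in S) B theta +
    br%:E * \int[mua]_(theta in S) (g theta) ^+ 2)%E.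
  apply: (@le_trans _ _ (\int[mua]_(theta in S)
      ((t / 2)%:E * B theta + br%:E * (g theta) ^+ 2))%E).
    apply: ge0_le_integral => //.
    - by move=> theta _; apply: integral_ge0 => rho _; rewrite lee_fin sqr_ge0.
    - apply: measurable_funTS.
      apply: (@measurable_inner_integral R n mur
        (fun p => f ((p.1 : R) *: (p.2 : 'rV[R]_n)) ^+ 2)) => //.
        exact: measurable_along_rays mq2.
      by move=> p; exact: sqr_ge0.
    - by apply: emeasurable_funD; apply: measurable_funeM.
    - move=> theta _.
      have nf : smooth_near (@halfline R)
          ((fun r : R^o => f (r *: theta)) : R^o -> R).
        by exists setT; split=> //; [exact: openT|exact: smooth_ray].
      apply: (le_trans (spr nf)); rewrite leeD2r//.
      rewrite lee_wpmul2l ?lee_fin ?(ltW t20)//.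
      rewrite le_eqVlt; apply/orP; left; apply/eqP.
      apply: eq_integral => rho _; congr (_%:E).
      by rewrite real_normK ?num_real// derive1_ray.
  rewrite ge0_integralD//; last 4 first.
  - by move=> theta _; rewrite mule_ge0// lee_fin ltW.
  - exact: measurable_funeM.
  - by move=> theta _; rewrite mule_ge0// lee_fin ltW.
  - exact: measurable_funeM.
  by rewrite !ge0_integralZl// lee_fin ltW.
have s0 : 0 < t / (2 * m2 * br) by rewrite divr_gt0// !mulr_gt0.
have tangential := tangential_super_poincare s0 b1 m20 m2E spa sf.
rewrite energyE; apply: (le_trans radial).
apply: (@le_trans _ _ ((t / 2)%:E * \int[mua]_(theta in S) B theta +
  br%:E * ((t / (2 * m2 * br) * m2)%:E * \int[mua]_(theta in S) C theta +
    b%:E * L1 ^+ 2))%E).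
  by rewrite leeD2l// lee_wpmul2l ?lee_fin ?(ltW br0).
have IB0 : (0 <= \int[mua]_(theta in S) B theta)%E by exact: integral_ge0.
have IC0 : (0 <= \int[mua]_(theta in S) C theta)%E by exact: integral_ge0.
have L0 : (0 <= L1 ^+ 2)%E by exact: sqre_ge0.
move: IB0 IC0 L0; move: (L1 ^+ 2)%E => w.
move: (\int[mua]_(theta in S) B theta)%E (\int[mua]_(theta in S) C theta)%E.
move=> u v u0 v0 w0.
rewrite ge0_muleDr; last 2 first.
- by rewrite mule_ge0// lee_fin ltW// mulr_gt0.
- by rewrite mule_ge0// lee_fin (le_trans ler01).
rewrite !muleA -!EFinM addeA leeD2r//.
have -> : br * (t / (2 * m2 * br) * m2) = t / 2.
  by field; rewrite !gt_eqF.
rewrite -ge0_muleDr// lee_wpmul2r ?adde_ge0// lee_fin.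
by move: t0; lra.
Qed.

End product_bound.

Theorem theorem3p3 (R : realType) (n : nat) (n2 : (2 <= n)%N)
    (Vr : R -> R) (Va : 'rV[R]_n -> R)
    (sigma : probability (Rn R n) R) (sigma_unif : uniform_sphere sigma)
    (mur : probability (measurableTypeR R) R) (mua mu : probability (Rn R n) R)
    (mu_nearly_radial : nearly_radial Vr Va sigma mur mua mu)
    (t : R) (t0 : 0 < t) :
  let m2 : \bar R := (\int[mu]_x ((enorm x) ^+ 2)%:E)%E in
  let br : \bar R := betaSP_halfline mur (t / 2) in
  (betaSP_Rn mu t
     <= br * betaSP_sphere mua (fine (t%:E / (2%:E * m2 * br))))%E.
Proof.
have [dr da muE] := mu_nearly_radial.
have murD := density_carried (measurable_halfline (R := R)) dr.
have muaS := density_carried (measurable_sphere (n := n)) da.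
cbv zeta; set m2 := (\int[mu]_x _)%E; set br := betaSP_halfline _ _.
have br1 : (1 <= br)%E by exact: betaSP_ge1.
set ba := betaSP_sphere _ _.
have ba1 : (1 <= ba)%E by exact: betaSP_ge1.
have [->|baoo] := eqVneq ba +oo%E.
  by rewrite gt0_muley ?leey// (lt_le_trans _ br1)// lte_fin.
have [broo|brfin] := eqVneq br +oo%E.
  by rewrite broo gt0_mulye ?leey// (lt_le_trans _ ba1)// lte_fin.
have brnum : br \is a fin_num.
  by rewrite ge0_fin_numE ?ltey// (le_trans _ br1).
have banum : ba \is a fin_num.
  by rewrite ge0_fin_numE ?ltey// (le_trans _ ba1).
have m2_ge0 : (0 <= m2)%E.
  by apply: integral_ge0 => x _; rewrite lee_fin sqr_ge0.
(* the second factor is finite only if its argument is positive *)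
have arg_pos : 0 < fine (t%:E / (2%:E * m2 * br))%E.
  by move: baoo; rewrite /ba /betaSP_sphere /betaSP; case: ifP.
have m2n0 : m2 != 0%E.
  apply/eqP => m20; move: arg_pos.
  by rewrite m20 mule0 mul0e inve0 gt0_muley ?lte_fin//= ltxx.
have m2noo : m2 != +oo%E.
  apply/eqP => m2oo; move: arg_pos.
  rewrite m2oo gt0_muley ?lte_fin// gt0_mulye ?(lt_le_trans _ br1) ?lte_fin//.
  by rewrite invey mule0 /= ltxx.
have m2num : m2 \is a fin_num by rewrite ge0_fin_numE// ltey.
have m2pos : 0 < fine m2 by rewrite fine_gt0// lt_def m2n0 m2_ge0 ltey.
have br1' : 1 <= fine br by rewrite -lee_fin fineK.
have ba1' : 1 <= fine ba by rewrite -lee_fin fineK.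
have brpos : 0 < fine br := lt_le_trans ltr01 br1'.
have argE : fine (t%:E / (2%:E * m2 * br))%E = t / (2 * fine m2 * fine br).
  rewrite -(fineK m2num) -(fineK brnum) -!EFinM inver ifF//.
  by apply/gt_eqF; rewrite !mulr_gt0.
rewrite -(fineK brnum) -(fineK banum) -EFinM.
apply: betaSP_le => //.
- by move=> f sf; exact: smooth_measurable.
- by rewrite lee_fin mulr_ege1.
apply: (@polar_super_poincare R n mur mua mu murD muaS muE t _ _ (fine m2)) => //.
- by rewrite fineK// /m2 (second_moment_polar murD muaS muE).
- rewrite fineK//; apply: betaSP_attained; first by rewrite divr_gt0.
  by rewrite -/br ltey.
- rewrite fineK// -argE; apply: betaSP_attained => //.
  by rewrite -/ba ltey.
Qed.
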